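(* Let $M$ be a complex manifold of complex dimension $n$, let $x\in M$, and let $\pi:\tilde M\to M$ be the blow up of $M$ at $x$ with exceptional divisor $E=\pi^{-1}(x)$. Let $K_M$ and $K_{\tilde M}$ be the canonical bundles of $M$ and $\tilde M$, and let $\tilde K_M=\pi^*(K_M)$. Then $$K_{\tilde M} = \tilde K_M\otimes[(n-1)E]$$ as holomorphic line bundles on $\tilde M$ (i.e. up to isomorphism).
   Context: The canonical bundle of a complex $n$-manifold is the line bundle of holomorphic $n$-forms, i.e. the top exterior power of the holomorphic cotangent bundle. Blow up: choose local holomorphic coordinates $z=(z_1,\dots,z_n)$ centered at $x$ on a neighborhood $U$ of $x$. Set $\tilde U=\{(z,l)\in U\times\mathbb{P}^{n-1}: z_il_j=z_jl_i \text{ for all } i,j\}$ with $\pi(z,l)=z$. The blow up $\tilde M$ is obtained from $M\setminus\{x\}$ and $\tilde U$ by gluing along $\pi:\tilde U\setminus\pi^{-1}(x)\cong U\setminus\{x\}$; it is independent of coordinates, and $E=\pi^{-1}(x)\cong\mathbb{P}^{n-1}$ is a smooth hypersurface called the exceptional divisor. Line bundle of a divisor: if a divisor $D$ (a locally finite integer combination of irreducible analytic hypersurfaces) has local defining meromorphic functions $f_\alpha$ on an open cover $\{U_\alpha\}$, then $[D]$ is the holomorphic line bundle with transition functions $g_{\alpha\beta}=f_\alpha/f_\beta$ on $U_\alpha\cap U_\beta$. *)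

(* Defs.v *)
From HB Require Import structures.
From mathcomp Require Import all_boot all_order all_algebra.
From mathcomp.real_closed Require Import complex.
From mathcomp Require Import boolp classical_sets functions reals topology.
From mathcomp Require Import normedtype landau derive.

Set Implicit Arguments.
Unset Strict Implicit.
Unset Printing Implicit Defensive.

Import Order.TTheory GRing.Theory Num.Theory numFieldNormedType.Exports.

Local Open Scope classical_set_scope.
Local Open Scope ring_scope.

(* k times complex differentiable at the points of A. *)
Fixpoint cdiff (K : numFieldType) (m k : nat) (A : set 'rV[K]_m)
    (f : 'rV[K]_m -> K) : Prop :=
  if k is k'.+1 then
    (forall z, A z -> differentiable f z) /\
    (forall v, cdiff k' A (fun z => 'D_v f z))
  else True.

(* Meant for K the field of complex numbers and A open: smooth functions whose
   differential is complex linear, i.e. solutions of dbar f = 0.  Requiring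
   derivatives of all orders does not change the notion. *)
Definition holomorphic (K : numFieldType) (m : nat) (A : set 'rV[K]_m)
    (f : 'rV[K]_m -> K) : Prop :=
  forall k, cdiff k A f.

Section Calculus.
Context {K : numFieldType}.

Lemma differentiable_near (V W : normedModType K) (f g : V -> W) (z : V) :
  (\forall w \near z, f w = g w) -> differentiable f z -> differentiable g z.
Proof.
move=> fg df.
have fgz : f z = g z by apply: (@nbhs_singleton _ z (fun w => f w = g w)).
have E : g \o shift z = cst (g z) + 'd f z +o_ 0 id.
  apply/eqaddoP => e e0; have /eqaddoP/(_ e e0) := diff_locally df.
  rewrite (near_shift 0 z) in fg.
  move: fg; apply: filterS2 => w; rewrite /= subr0 => fgw.
  by rewrite /= !fctE /= fgw fgz.
have D : 'd g z = 'd f z :> (V -> W).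
  by apply: diff_unique E; exact: diff_continuous.
by apply/diff_locallyP; rewrite D; split => //; exact: diff_continuous.
Qed.

Lemma near_open (T : topologicalType) (A : set T) (P : T -> Prop) (z : T) :
  open A -> A z -> (forall w, A w -> P w) -> \forall w \near z, P w.
Proof. by move=> oA Az AP; apply: filterS AP _; exact: open_nbhs_nbhs. Qed.

Lemma cdiff_le m k (A : set 'rV[K]_m) f : cdiff k.+1 A f -> cdiff k A f.
Proof.
elim: k f => [//|k IH] f [df Df]; split=> // v.
by apply: IH; apply: Df.
Qed.

Lemma cdiff_sub m k (A B : set 'rV[K]_m) f :
  B `<=` A -> cdiff k A f -> cdiff k B f.
Proof.
move=> BA; elim: k f => [//|k IH] f [df Df].
by split=> [z /BA/df//|v]; apply/IH/Df.
Qed.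

Lemma cdiff_local m k (A : set 'rV[K]_m) f :
  (forall z, A z -> exists2 B : set 'rV[K]_m, B z & cdiff k B f) -> cdiff k A f.
Proof.
elim: k f => [//|k IH] f loc; split=> [z /loc[B Bz [df _]]|v]; first exact: df.
by apply: IH => z /loc[B Bz [_ Df]]; exists B => //; exact: Df.
Qed.

Lemma derive_near (V W : normedModType K) (f g : V -> W) (z v : V) :
  (\forall w \near z, f w = g w) -> 'D_v f z = 'D_v g z.
Proof.
move=> fg; have [->|v0] := eqVneq v 0; first by rewrite !derive0.
exact: near_eq_derive.
Qed.

Lemma cdiff_ext m k (A : set 'rV[K]_m) f g : open A ->
  (forall z, A z -> f z = g z) -> cdiff k A f -> cdiff k A g.
Proof.
move=> oA; elim: k f g => [//|k IH] f g fg [df Df].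
have nfg z : A z -> \forall w \near z, f w = g w by move=> Az; apply: (near_open oA Az) => w; exact: fg.
split=> [z Az|v]; first exact: differentiable_near (nfg _ Az) (df _ Az).
by apply: IH (Df v) => z Az; apply: derive_near; exact: nfg.
Qed.

Lemma cdiff_cst m k (A : set 'rV[K]_m) c : cdiff k A (fun=> c).
Proof.
elim: k c => [//|k IH] c; split=> [z _|v]; first exact: differentiable_cst.
suff -> : (fun z : 'rV[K]_m => 'D_v (fun=> c) z) = (fun=> 0) by exact: IH.
by apply/funext => z; exact: derive_cst.
Qed.

Lemma diff_coord m (j : 'I_m) (z v : 'rV[K]_m) :
  'd (fun w : 'rV[K]_m => w ord0 j) z v = v ord0 j.
Proof.
have @l : {linear 'rV[K]_m -> K}.
  by exists (fun N : 'rV[K]_m => N ord0 j); do 2![eexists]; do ?[constructor];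
     rewrite ?mxE// => ? *; rewrite ?mxE//; move=> ?; rewrite !mxE.
rewrite (_ : (fun w : 'rV[K]_m => w ord0 j) = l)// diff_lin//.
exact/coord_continuous.
Qed.

Lemma derive_coord m (j : 'I_m) (z v : 'rV[K]_m) :
  'D_v (fun w : 'rV[K]_m => w ord0 j) z = v ord0 j.
Proof. by rewrite deriveE ?diff_coord//; exact: differentiable_coord. Qed.

Lemma cdiff_coord m k (A : set 'rV[K]_m) j : cdiff k A (fun z => z ord0 j).
Proof.
case: k => [//|k]; split=> [z _|v]; first exact: differentiable_coord.
by under eq_fun do rewrite derive_coord; exact: cdiff_cst.
Qed.

Lemma cdiffD m k (A : set 'rV[K]_m) f g : open A ->
  cdiff k A f -> cdiff k A g -> cdiff k A (fun z => f z + g z).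
Proof.
move=> oA; elim: k f g => [//|k IH] f g [df Df] [dg Dg].
split=> [z Az|v]; first by apply: differentiableD; [exact: df|exact: dg].
apply: (cdiff_ext oA) (IH _ _ (Df v) (Dg v)) => z Az /=.
by rewrite deriveD//; apply: diff_derivable; [exact: df|exact: dg].
Qed.

Lemma cdiffM m k (A : set 'rV[K]_m) f g : open A ->
  cdiff k A f -> cdiff k A g -> cdiff k A (fun z => f z * g z).
Proof.
move=> oA; elim: k f g => [//|k IH] f g kf kg.
case: (kf) (kg) => [df Df] [dg Dg].
split=> [z Az|v]; first by apply: differentiableM; [exact: df|exact: dg].
have H := cdiffD oA (IH _ _ (cdiff_le kf) (Dg v)) (IH _ _ (cdiff_le kg) (Df v)).
apply: (cdiff_ext oA) H => z Az /=.
by rewrite deriveM//; apply: diff_derivable; [exact: df|exact: dg].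
Qed.

Lemma cdiffV m k (A : set 'rV[K]_m) f : open A ->
  (forall z, A z -> f z != 0) -> cdiff k A f -> cdiff k A (fun z => (f z)^-1).
Proof.
move=> oA f0; elim: k => [//|k IH] kf; case: (kf) => df Df.
split=> [z Az|v]; first by apply: differentiableV; [exact: df|exact: f0].
have kV := IH (cdiff_le kf).
have H := cdiffM oA (cdiff_cst k A (-1)) (cdiffM oA (cdiffM oA kV kV) (Df v)).
apply: (cdiff_ext oA) H => z Az /=.
rewrite deriveV//; [|exact: f0|by apply: diff_derivable; exact: df].
by rewrite mulN1r scaleNr expr2 invfM.
Qed.

Lemma cdiff_sum m k (A : set 'rV[K]_m) (I : Type) (r : seq I) (P : pred I) F :
  open A -> (forall i, cdiff k A (F i)) ->
  cdiff k A (fun z => \sum_(i <- r | P i) F i z).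
Proof.
move=> oA HF; elim: r => [|i r IH].
  by under eq_fun do rewrite big_nil; exact: cdiff_cst.
under eq_fun do rewrite big_cons.
by case: (P i) => //; exact: cdiffD.
Qed.

Lemma cdiff_prod m k (A : set 'rV[K]_m) (I : Type) (r : seq I) (P : pred I) F :
  open A -> (forall i, cdiff k A (F i)) ->
  cdiff k A (fun z => \prod_(i <- r | P i) F i z).
Proof.
move=> oA HF; elim: r => [|i r IH].
  by under eq_fun do rewrite big_nil; exact: cdiff_cst.
under eq_fun do rewrite big_cons.
by case: (P i) => //; exact: cdiffM.
Qed.

Lemma differentiable_row (V : normedModType K) n (f : V -> 'rV[K]_n) z :
  (forall j, differentiable (fun w => f w ord0 j) z) -> differentiable f z.
Proof.
move=> df.
rewrite (_ : f = \sum_(j < n) (fun w => f w ord0 j *: delta_mx ord0 j)).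
  by apply: differentiable_sum => j; exact: differentiableZl.
by apply/funext => w; rewrite fct_sumE; exact: row_sum_delta.
Qed.

Lemma derive_entry (V : normedModType K) n (f : V -> 'rV[K]_n) z v j :
  (forall j, differentiable (fun w => f w ord0 j) z) ->
  'D_v (fun w => f w ord0 j) z = 'd f z v ord0 j.
Proof.
move=> df; have dfz := differentiable_row df; rewrite deriveE//.
have := @diff_comp _ _ _ _ f (fun w : 'rV[K]_n => w ord0 j) z dfz
  (differentiable_coord _ _ _).
by move=> /(congr1 (fun h => h v)) /= ->; rewrite diff_coord.
Qed.

Lemma jacobian_entry m n (f : 'rV[K]_m -> 'rV[K]_n) z a b :
  (forall j, differentiable (fun w => f w ord0 j) z) ->
  'J f z a b = 'D_(delta_mx ord0 a) (fun w => f w ord0 b) z.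
Proof. by move=> df; rewrite derive_entry// mxE. Qed.

Lemma derive_comp_row (V : normedModType K) n (f : V -> 'rV[K]_n) (g : 'rV[K]_n -> K)
    z v : (forall j, differentiable (fun w => f w ord0 j) z) ->
  differentiable g (f z) ->
  'D_v (g \o f) z =
  \sum_(j < n) 'D_v (fun w => f w ord0 j) z * 'D_(delta_mx ord0 j) g (f z).
Proof.
move=> df dg; have dfz := differentiable_row df.
rewrite deriveE; last exact: differentiable_comp.
rewrite diff_comp//= [X in 'd g _ X]row_sum_delta linear_sum.
apply: eq_bigr => j _; rewrite linearZ /= derive_entry// deriveE//.
Qed.

Lemma cdiff_comp m n k (A : set 'rV[K]_m) (B : set 'rV[K]_n)
    (f : 'rV[K]_m -> 'rV[K]_n) (g : 'rV[K]_n -> K) : open A ->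
  (forall z, A z -> B (f z)) -> (forall j, cdiff k A (fun z => f z ord0 j)) ->
  cdiff k B g -> cdiff k A (g \o f).
Proof.
move=> oA AB; elim: k g => [//|k IH] g kf [dg Dg].
have df z : A z -> forall j, differentiable (fun w => f w ord0 j) z.
  by move=> Az j; case: (kf j) => + _; apply.
split=> [z Az|v].
  by apply: differentiable_comp; [exact/differentiable_row/df|exact/dg/AB].
have H : cdiff k A (fun z => \sum_(j < n)
    'D_v (fun w => f w ord0 j) z * ('D_(delta_mx ord0 j) g \o f) z).
  apply: cdiff_sum => // j; apply: cdiffM => //.
    by case: (kf j) => _; apply.
  by apply: IH => [i|]; [exact/cdiff_le/kf|exact: Dg].
apply: (cdiff_ext oA) H => z Az /=.
by rewrite derive_comp_row//; [exact: df|exact/dg/AB].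
Qed.

Lemma cdiff_det m k (A : set 'rV[K]_m) r (F : 'rV[K]_m -> 'M[K]_r) : open A ->
  (forall a b, cdiff k A (fun z => F z a b)) -> cdiff k A (fun z => \det (F z)).
Proof.
move=> oA HF; rewrite /determinant; apply: cdiff_sum => // s.
by apply: cdiffM => //; [exact: cdiff_cst|exact: cdiff_prod].
Qed.

Lemma cdiff_invmx m k (A : set 'rV[K]_m) r (F : 'rV[K]_m -> 'M[K]_r) : open A ->
  (forall z, A z -> F z \in unitmx) ->
  (forall a b, cdiff k A (fun z => F z a b)) ->
  forall a b, cdiff k A (fun z => invmx (F z) a b).
Proof.
move=> oA uF HF a b.
have H : cdiff k A (fun z => (\det (F z))^-1 * cofactor (F z) b a).
  apply: cdiffM => //.
    apply: cdiffV => //; last exact: cdiff_det.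
    by move=> z /uF; rewrite unitmxE unitfE.
  rewrite /cofactor; apply: cdiffM => //; first exact: cdiff_cst.
  apply: cdiff_det => // c d.
  by under eq_fun do rewrite !mxE; exact: HF.
by apply: (cdiff_ext oA) H => z Az; rewrite /invmx uF// !mxE.
Qed.

Lemma cdiff_mulmx m k (A : set 'rV[K]_m) p q r (F : 'rV[K]_m -> 'M[K]_(p, q))
    (G : 'rV[K]_m -> 'M[K]_(q, r)) : open A ->
  (forall a b, cdiff k A (fun z => F z a b)) ->
  (forall a b, cdiff k A (fun z => G z a b)) ->
  forall a b, cdiff k A (fun z => (F z *m G z) a b).
Proof.
move=> oA HF HG a b; under eq_fun do rewrite mxE.
by apply: cdiff_sum => // j; apply: cdiffM.
Qed.

End Calculus.

(* R[i] packed as a numFieldType: the normed module structure of a numFieldType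
   is not inferred on the bare type R[i]. *)
Definition Cplx (R : realType) : numFieldType := R[i].

(* cto and cfrom are only meaningful on cdom and ccod. *)
Record chart (R : realType) (n : nat) (X : topologicalType) := Chart {
  cdom : set X;
  ccod : set 'rV[Cplx R]_n;
  cto : X -> 'rV[Cplx R]_n;
  cfrom : 'rV[Cplx R]_n -> X;
  cdom_open : open cdom;
  ccod_open : open ccod;
  cto_cod : forall p, cdom p -> ccod (cto p);
  cfrom_dom : forall z, ccod z -> cdom (cfrom z);
  ctoK : forall p, cdom p -> cfrom (cto p) = p;
  cfromK : forall z, ccod z -> cto (cfrom z) = z;
  cto_continuous : forall p, cdom p -> {for p, continuous cto};
  cfrom_continuous : forall z, ccod z -> {for z, continuous cfrom}
}.

Arguments cdom_open {R n X} c : rename.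
Arguments ccod_open {R n X} c : rename.
Arguments cto_cod {R n X} c [p] _ : rename.
Arguments cfrom_dom {R n X} c [z] _ : rename.
Arguments ctoK {R n X} c [p] _ : rename.
Arguments cfromK {R n X} c [z] _ : rename.
Arguments cto_continuous {R n X} c [p] _ : rename.
Arguments cfrom_continuous {R n X} c [z] _ : rename.

Definition transition_holomorphic (R : realType) (n : nat) (X : topologicalType)
    (c d : chart R n X) : Prop :=
  forall k, holomorphic (ccod c `&` cfrom c @^-1` cdom d)
                        (fun z => cto d (cfrom c z) ord0 k).

(* The atlas need not be maximal; see holomorphic_chart. *)
Record complex_manifold (R : realType) (n : nat) := ComplexManifold {
  space :> topologicalType;
  atlas_index : Type;
  atlas : atlas_index -> chart R n space;
  space_hausdorff : hausdorff_space space;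
  space_second_countable : @second_countable space;
  atlas_cover : forall p, exists i, cdom (atlas i) p;
  atlas_transition : forall i j, transition_holomorphic (atlas i) (atlas j)
}.

Arguments atlas {R n} c i : rename.
Arguments atlas_cover {R n} c p : rename.
Arguments atlas_transition {R n} c i j k : rename.

(* c belongs to the maximal atlas, i.e. c is a local holomorphic coordinate
   system of M. *)
Definition holomorphic_chart (R : realType) (n : nat) (M : complex_manifold R n)
    (c : chart R n M) : Prop :=
  forall i, transition_holomorphic (atlas M i) c /\
            transition_holomorphic c (atlas M i).

Definition holomorphic_fun (R : realType) (n : nat) (M : complex_manifold R n)
    (W : set M) (f : M -> Cplx R) : Prop :=
  forall i, holomorphic (ccod (atlas M i) `&` cfrom (atlas M i) @^-1` W)
                        (fun z => f (cfrom (atlas M i) z)).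

Definition holomorphic_on (R : realType) (m n : nat) (M : complex_manifold R m)
    (N : complex_manifold R n) (W : set M) (F : M -> N) : Prop :=
  (forall p, W p -> {for p, continuous F}) /\
  forall i j k,
    holomorphic
      (ccod (atlas M i) `&` cfrom (atlas M i) @^-1` (W `&` F @^-1` cdom (atlas N j)))
      (fun z => cto (atlas N j) (F (cfrom (atlas M i) z)) ord0 k).

Record holomorphic_map (R : realType) (m n : nat) (M : complex_manifold R m)
    (N : complex_manifold R n) := HolomorphicMap {
  map_fun :> M -> N;
  map_holomorphic : holomorphic_on [set: M] map_fun
}.

(* A holomorphic vector bundle of rank r given by local trivializations over an
   open cover: the column vectors s_i, s_j of coordinates of a vector in the
   trivializations i and j are related by s_i = vb_trans i j *m s_j. *)
Record vector_bundle (R : realType) (n : nat) (M : complex_manifold R n)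
    (r : nat) := VectorBundle {
  vb_index : Type;
  vb_dom : vb_index -> set M;
  vb_trans : vb_index -> vb_index -> M -> 'M[Cplx R]_r;
  vb_dom_open : forall i, open (vb_dom i);
  vb_cover : forall p, exists i, vb_dom i p;
  vb_trans_holomorphic : forall i j a b,
    holomorphic_fun (vb_dom i `&` vb_dom j) (fun p => vb_trans i j p a b);
  vb_trans_id : forall i p, vb_dom i p -> vb_trans i i p = 1%:M;
  vb_trans_comp : forall i j k p, vb_dom i p -> vb_dom j p -> vb_dom k p ->
    vb_trans i j p *m vb_trans j k p = vb_trans i k p
}.

Arguments vb_dom {R n M r} v i _ : rename.
Arguments vb_trans {R n M r} v i j p : rename.
Arguments vb_cover {R n M r} v p : rename.
Arguments vb_dom_open {R n M r} v i : rename.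
Arguments vb_trans_holomorphic {R n M r} v i j a b : rename.
Arguments vb_trans_id {R n M r} v i p _ : rename.
Arguments vb_trans_comp {R n M r} v i j k p _ _ _ : rename.

Notation line_bundle M := (vector_bundle M 1).

(* A holomorphic bundle isomorphism E -> F, read in the trivializations of E and
   F: s_a = h i a *m s_i. *)
Definition bundle_iso (R : realType) (n : nat) (M : complex_manifold R n)
    (r : nat) (E F : vector_bundle M r) : Prop :=
  exists h : vb_index E -> vb_index F -> M -> 'M[Cplx R]_r,
    [/\ forall i a s t,
          holomorphic_fun (vb_dom E i `&` vb_dom F a) (fun p => h i a p s t),
        forall i a p, vb_dom E i p -> vb_dom F a p -> h i a p \in unitmx
      & forall i j a b p,
          vb_dom E i p -> vb_dom E j p -> vb_dom F a p -> vb_dom F b p ->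
          h j b p *m vb_trans E j i p = vb_trans F b a p *m h i a p].

Section Bundles.
Context {R : realType} {n : nat} {M : complex_manifold R n}.

Lemma open_preimage (X Y : topologicalType) (A : set X) (B : set Y) (f : X -> Y) :
  open A -> (forall x, A x -> {for x, continuous f}) -> open B ->
  open (A `&` f @^-1` B).
Proof.
move=> oA cf oB; rewrite openE => x [Ax Bfx].
apply: filterI; first exact: open_nbhs_nbhs.
by apply: (cf _ Ax); exact: open_nbhs_nbhs.
Qed.

Lemma chart_open (X : topologicalType) (c : chart R n X) (W : set X) :
  open W -> open (ccod c `&` cfrom c @^-1` W).
Proof.
by move=> oW; apply: open_preimage => //; [exact: ccod_open|exact: cfrom_continuous].
Qed.

Arguments chart_open {X} c [W] _.

Lemma vb_open2 r (E : vector_bundle M r) i j : open (vb_dom E i `&` vb_dom E j).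
Proof. by apply: openI; exact: vb_dom_open. Qed.

Arguments vb_open2 {r} E i j.

Lemma vb_trans_unit r (E : vector_bundle M r) i j p :
  vb_dom E i p -> vb_dom E j p -> vb_trans E i j p \in unitmx.
Proof.
move=> ip jp; have := vb_trans_comp E i j i p ip jp ip; rewrite vb_trans_id//.
by case/mulmx1_unit.
Qed.

(* 'J acts on row vectors: entry (s, t) is the derivative of the t-th coordinate
   of d with respect to the s-th coordinate of c. *)
Definition chart_jacobian (X : topologicalType) (c d : chart R n X) (p : X) :
  'M[Cplx R]_n := 'J (cto d \o cfrom c) (cto c p).

Lemma transition_differentiable (X : topologicalType) (c d : chart R n X) p :
  transition_holomorphic c d -> cdom c p -> cdom d p ->
  forall k, differentiable (fun z => (cto d \o cfrom c) z ord0 k) (cto c p).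
Proof.
move=> cd cp dp k; have [+ _] := cd k 1%N; apply.
by split=> /=; [exact: cto_cod|rewrite ctoK].
Qed.

Lemma chart_jacobian_id (X : topologicalType) (c : chart R n X) p :
  cdom c p -> chart_jacobian c c p = 1%:M.
Proof.
move=> cp; have E (j : 'I_n) : \forall w \near cto c p,
    (fun w : 'rV[Cplx R]_n => w ord0 j) w = (cto c \o cfrom c) w ord0 j.
  apply: (near_open (ccod_open c) (cto_cod c cp)) => w cw /=.
  by rewrite cfromK.
apply/matrixP => a b; rewrite jacobian_entry => [|j].
  by rewrite -(derive_near _ (E b)) derive_coord !mxE eqxx eq_sym.
by apply: differentiable_near (E j) _; exact: differentiable_coord.
Qed.

Lemma chart_jacobian_comp (X : topologicalType) (c d e : chart R n X) p :
  transition_holomorphic c d -> transition_holomorphic d e ->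
  transition_holomorphic c e ->
  cdom c p -> cdom d p -> cdom e p ->
  chart_jacobian c d p *m chart_jacobian d e p = chart_jacobian c e p.
Proof.
move=> cd de ce cp dp ep.
have dcd := transition_differentiable cd cp dp.
have dde := transition_differentiable de dp ep.
have dce := transition_differentiable ce cp ep.
apply/matrixP => a b.
rewrite [RHS](jacobian_entry _ _ dce).
rewrite [LHS]mxE.
have E : \forall w \near cto c p, ((fun w => (cto e \o cfrom d) w ord0 b) \o
    (cto d \o cfrom c)) w = (cto e \o cfrom c) w ord0 b.
  apply: (near_open (chart_open c (cdom_open d))); last first.
    by move=> w [/= cw dw]; rewrite ctoK.
  by split=> /=; [exact: cto_cod|rewrite ctoK].
rewrite -(derive_near _ E).
have eqp : (cto d \o cfrom c) (cto c p) = cto d p by rewrite /comp ctoK.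
have dg : differentiable (fun w => (cto e \o cfrom d) w ord0 b)
    ((cto d \o cfrom c) (cto c p)).
  by rewrite eqp; exact: dde.
rewrite (derive_comp_row _ dcd dg).
apply: eq_bigr => j _.
rewrite [X in X * _](jacobian_entry _ _ dcd).
rewrite [X in _ * X](jacobian_entry _ _ dde).
by rewrite eqp.
Qed.

Lemma chart_jacobian_holomorphic i j a b :
  holomorphic_fun (cdom (atlas M i) `&` cdom (atlas M j))
    (fun p => chart_jacobian (atlas M i) (atlas M j) p a b).
Proof.
move=> l k; set A := (X in cdiff k X); set c := atlas M l.
have oA : open A.
  by apply: chart_open; apply: openI; exact: cdom_open.
pose d := atlas M i; pose e := atlas M j.
pose B := ccod d `&` cfrom d @^-1` cdom e.
pose f := fun z => cto d (cfrom c z).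
have H : cdiff k A
    ((fun w => 'D_(delta_mx ord0 a) (fun w => (cto e \o cfrom d) w ord0 b) w) \o f).
  apply: (cdiff_comp (B := B)) => //.
  - move=> z [/= cz [dz ez]]; rewrite /B /f /=; split; first exact: cto_cod.
    by rewrite ctoK.
  - move=> s; have := atlas_transition M l i s; move/(_ k); apply: cdiff_sub.
    by move=> z [/= cz [dz ez]].
  - by have [_] := atlas_transition M i j b k.+1; apply.
apply: (cdiff_ext oA) H => z [/= cz [dz ez]].
rewrite /chart_jacobian jacobian_entry//.
exact: (transition_differentiable (@atlas_transition _ _ _ i j)).
Qed.

Lemma tangent_trans_holomorphic i j a b :
  holomorphic_fun (cdom (atlas M i) `&` cdom (atlas M j))
    (fun p => (chart_jacobian (atlas M j) (atlas M i) p)^T a b).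
Proof.
move=> l k; under eq_fun do rewrite mxE.
by rewrite (setIC (cdom _)); exact: chart_jacobian_holomorphic.
Qed.

Lemma tangent_trans_id i p : cdom (atlas M i) p ->
  (chart_jacobian (atlas M i) (atlas M i) p)^T = 1%:M.
Proof. by move=> ip; rewrite chart_jacobian_id// trmx1. Qed.

Lemma tangent_trans_comp i j k p :
  cdom (atlas M i) p -> cdom (atlas M j) p -> cdom (atlas M k) p ->
  (chart_jacobian (atlas M j) (atlas M i) p)^T *m
  (chart_jacobian (atlas M k) (atlas M j) p)^T =
  (chart_jacobian (atlas M k) (atlas M i) p)^T.
Proof.
move=> ip jp kp; rewrite -trmx_mul chart_jacobian_comp//;
exact: atlas_transition.
Qed.

(* Trivialized over cdom c by the coordinate fields d/dz_k of the chart c. *)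
Definition tangent_bundle : vector_bundle M n :=
  {| vb_index := atlas_index M;
     vb_dom := fun i => cdom (atlas M i);
     vb_trans := fun i j p => (chart_jacobian (atlas M j) (atlas M i) p)^T;
     vb_dom_open := fun i => cdom_open (atlas M i);
     vb_cover := atlas_cover M;
     vb_trans_holomorphic := tangent_trans_holomorphic;
     vb_trans_id := tangent_trans_id;
     vb_trans_comp := tangent_trans_comp |}.

Section Dual.
Context {r : nat} (E : vector_bundle M r).

Lemma dual_trans_holomorphic i j a b :
  holomorphic_fun (vb_dom E i `&` vb_dom E j)
    (fun p => invmx (vb_trans E i j p)^T a b).
Proof.
move=> l k; apply: cdiff_invmx; first exact/chart_open/vb_open2.
  by move=> z [/= _ [iz jz]]; rewrite unitmx_tr; exact: vb_trans_unit.
by move=> s t; under eq_fun do rewrite mxE; exact: vb_trans_holomorphic.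
Qed.

Lemma dual_trans_id i p : vb_dom E i p -> invmx (vb_trans E i i p)^T = 1%:M.
Proof. by move=> ip; rewrite vb_trans_id// trmx1 invmx1. Qed.

Lemma dual_trans_comp i j k p :
  vb_dom E i p -> vb_dom E j p -> vb_dom E k p ->
  invmx (vb_trans E i j p)^T *m invmx (vb_trans E j k p)^T =
  invmx (vb_trans E i k p)^T.
Proof.
move=> ip jp kp; rewrite -(vb_trans_comp E i j k p ip jp kp) trmx_mul.
have uij : (vb_trans E i j p)^T \in unitmx by rewrite unitmx_tr vb_trans_unit.
have ujk : (vb_trans E j k p)^T \in unitmx by rewrite unitmx_tr vb_trans_unit.
have u : (vb_trans E j k p)^T *m (vb_trans E i j p)^T \in unitmx.
  by rewrite unitmx_mul ujk.
apply: (can_inj (mulKmx u)); rewrite mulmxV// -mulmxA (mulmxA _ (invmx _)).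
by rewrite (mulmxV uij) mul1mx mulmxV.
Qed.

Definition dual_bundle : vector_bundle M r :=
  {| vb_index := vb_index E;
     vb_dom := vb_dom E;
     vb_trans := fun i j p => invmx (vb_trans E i j p)^T;
     vb_dom_open := vb_dom_open E;
     vb_cover := vb_cover E;
     vb_trans_holomorphic := dual_trans_holomorphic;
     vb_trans_id := dual_trans_id;
     vb_trans_comp := dual_trans_comp |}.

End Dual.

Section TopExteriorPower.
Context {r : nat} (E : vector_bundle M r).

Lemma det_trans_holomorphic i j (a b : 'I_1) :
  holomorphic_fun (vb_dom E i `&` vb_dom E j)
    (fun p => (\det (vb_trans E i j p))%:M a b).
Proof.
move=> l k; rewrite !ord1; under eq_fun do rewrite !mxE eqxx mulr1n.
apply: cdiff_det; first exact/chart_open/vb_open2.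
by move=> s t; exact: vb_trans_holomorphic.
Qed.

Lemma det_trans_id i p : vb_dom E i p ->
  (\det (vb_trans E i i p))%:M = 1%:M :> 'M_1.
Proof. by move=> ip; rewrite vb_trans_id// det1. Qed.

Lemma det_trans_comp i j k p :
  vb_dom E i p -> vb_dom E j p -> vb_dom E k p ->
  (\det (vb_trans E i j p))%:M *m (\det (vb_trans E j k p))%:M =
  (\det (vb_trans E i k p))%:M :> 'M_1.
Proof. by move=> ip jp kp; rewrite -scalar_mxM -det_mulmx vb_trans_comp. Qed.

(* The top exterior power of the matrix g : C^r -> C^r is its determinant. *)
Definition top_exterior_power : line_bundle M :=
  {| vb_index := vb_index E;
     vb_dom := vb_dom E;
     vb_trans := fun i j p => (\det (vb_trans E i j p))%:M;
     vb_dom_open := vb_dom_open E;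
     vb_cover := vb_cover E;
     vb_trans_holomorphic := det_trans_holomorphic;
     vb_trans_id := det_trans_id;
     vb_trans_comp := det_trans_comp |}.

End TopExteriorPower.

Section Tensor.
Context (L L' : line_bundle M).
Implicit Types i j k : (vb_index L * vb_index L')%type.

Local Notation dom i := (vb_dom L i.1 `&` vb_dom L' i.2).
Local Notation trans i j p := (vb_trans L i.1 j.1 p *m vb_trans L' i.2 j.2 p).

Lemma tensor_dom_open i : open (dom i).
Proof. by apply: openI; exact: vb_dom_open. Qed.

Lemma tensor_cover p : exists i, (dom i) p.
Proof.
have [i ip] := vb_cover L p; have [j jp] := vb_cover L' p.
by exists (i, j).
Qed.

Lemma tensor_trans_holomorphic i j a b :
  holomorphic_fun (dom i `&` dom j) (fun p => trans i j p a b).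
Proof.
move=> l k; apply: cdiff_mulmx; first by apply/chart_open/openI; exact: tensor_dom_open.
  move=> s t; apply: (cdiff_sub _ (vb_trans_holomorphic L i.1 j.1 s t l k)).
  by move=> z [/= ? [[? ?] [? ?]]].
move=> s t; apply: (cdiff_sub _ (vb_trans_holomorphic L' i.2 j.2 s t l k)).
by move=> z [/= ? [[? ?] [? ?]]].
Qed.

Lemma tensor_trans_id i p : (dom i) p -> trans i i p = 1%:M.
Proof. by move=> [? ?]; rewrite !vb_trans_id// mulmx1. Qed.

Lemma tensor_trans_comp i j k p : (dom i) p -> (dom j) p -> (dom k) p ->
  trans i j p *m trans j k p = trans i k p.
Proof.
move=> [i1 i2] [j1 j2] [k1 k2].
rewrite -(vb_trans_comp L _ _ _ p i1 j1 k1) -(vb_trans_comp L' _ _ _ p i2 j2 k2).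
rewrite -!mulmxA; congr (_ *m _); rewrite !mulmxA; congr (_ *m _).
by rewrite [vb_trans L' _ _ _]mx11_scalar scalar_mxC.
Qed.

(* The tensor product of 1 x 1 matrices is their product. *)
Definition tensor_bundle : line_bundle M :=
  {| vb_index := (vb_index L * vb_index L')%type;
     vb_dom := fun i => vb_dom L i.1 `&` vb_dom L' i.2;
     vb_trans := fun i j p =>
       vb_trans L i.1 j.1 p *m vb_trans L' i.2 j.2 p;
     vb_dom_open := tensor_dom_open;
     vb_cover := tensor_cover;
     vb_trans_holomorphic := tensor_trans_holomorphic;
     vb_trans_id := tensor_trans_id;
     vb_trans_comp := tensor_trans_comp |}.

End Tensor.

End Bundles.

Arguments chart_open {R n X} c [W] _.
Arguments vb_open2 {R n M r} E i j.
Arguments tangent_bundle {R n} M.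

Definition canonical_bundle (R : realType) (n : nat)
    (M : complex_manifold R n) : line_bundle M :=
  top_exterior_power (dual_bundle (tangent_bundle M)).

Section Pullback.
Context {R : realType} {m n : nat} {M : complex_manifold R m}
  {N : complex_manifold R n} (F : holomorphic_map M N).
Context {r : nat} (E : vector_bundle N r).

Lemma holomorphic_fun_comp (W : set N) (g : N -> Cplx R) : open W ->
  holomorphic_fun W g -> holomorphic_fun (F @^-1` W) (fun p => g (F p)).
Proof.
move=> oW hg i k; set c := atlas M i; have [cF hF] := map_holomorphic F.
have cont : continuous F by move=> p; exact: cF.
have oFW : open (F @^-1` W) by move/continuousP: cont; apply.
apply: cdiff_local => z [/= cz Wz].
have [j jFz] := atlas_cover N (F (cfrom c z)); set d := atlas N j.
pose B := ccod c `&` cfrom c @^-1` (F @^-1` (W `&` cdom d)).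
have oB : open B.
  apply: chart_open; move/continuousP: cont; apply.
  by apply: openI => //; exact: cdom_open.
exists B => //.
have H : cdiff k B ((fun w => g (cfrom d w)) \o (fun w => cto d (F (cfrom c w)))).
  apply: (cdiff_comp oB) (hg j k).
  - by move=> w [/= cw [Ww dw]]; split; [exact: cto_cod|rewrite /= ctoK].
  - move=> s; apply: (cdiff_sub _ (hF i j s k)).
    by move=> w [/= cw [Ww dw]].
by apply: (cdiff_ext oB) H => w [/= cw [Ww dw]]; rewrite ctoK.
Qed.

Lemma pullback_dom_open i : open (F @^-1` vb_dom E i).
Proof.
have [cF _] := map_holomorphic F.
have /continuousP : continuous F by move=> p; exact: cF.
by apply; exact: vb_dom_open.
Qed.

Lemma pullback_cover p : exists i, (F @^-1` vb_dom E i) p.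
Proof. exact: vb_cover. Qed.

Lemma pullback_trans_holomorphic i j a b :
  holomorphic_fun (F @^-1` vb_dom E i `&` F @^-1` vb_dom E j)
    (fun p => vb_trans E i j (F p) a b).
Proof.
exact: (holomorphic_fun_comp (vb_open2 E i j) (vb_trans_holomorphic E i j a b)).
Qed.

Lemma pullback_trans_id i p : (F @^-1` vb_dom E i) p ->
  vb_trans E i i (F p) = 1%:M.
Proof. exact: vb_trans_id. Qed.

Lemma pullback_trans_comp i j k p : (F @^-1` vb_dom E i) p ->
  (F @^-1` vb_dom E j) p -> (F @^-1` vb_dom E k) p ->
  vb_trans E i j (F p) *m vb_trans E j k (F p) = vb_trans E i k (F p).
Proof. exact: vb_trans_comp. Qed.

Definition pullback_bundle : vector_bundle M r :=
  {| vb_index := vb_index E;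
     vb_dom := fun i => F @^-1` vb_dom E i;
     vb_trans := fun i j p => vb_trans E i j (F p);
     vb_dom_open := pullback_dom_open;
     vb_cover := pullback_cover;
     vb_trans_holomorphic := pullback_trans_holomorphic;
     vb_trans_id := pullback_trans_id;
     vb_trans_comp := pullback_trans_comp |}.

End Pullback.

(* A hypersurface V is cut out on U by f, and f generates the ideal of V at
   each point of U: every germ vanishing on V is a multiple of f. *)
Definition local_defining_function (R : realType) (n : nat)
    (M : complex_manifold R n) (V U : set M) (f : M -> Cplx R) : Prop :=
  [/\ holomorphic_fun U f,
      forall p, U p -> (V p <-> f p = 0)
    & forall p (W : set M) (g : M -> Cplx R), U p -> open W -> W p ->
        holomorphic_fun W g -> (forall q, W q -> V q -> g q = 0) ->
        exists (W' : set M) (h : M -> Cplx R),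
          [/\ open W', W' p, W' `<=` U `&` W, holomorphic_fun W' h
            & forall q, W' q -> g q = h q * f q]].

(* L is the line bundle [kV] of the divisor kV, presented by local defining
   functions f_a of V: the transition functions are f_a^k / f_b^k.  The quotient
   is taken off V, where it is defined pointwise; its extension across V is
   determined by holomorphy of the transition functions of L. *)
Definition divisor_line_bundle (R : realType) (n : nat)
    (M : complex_manifold R n) (k : int) (V : set M) (L : line_bundle M) : Prop :=
  exists f : vb_index L -> M -> Cplx R,
    (forall a, local_defining_function V (vb_dom L a) (f a)) /\
    (forall a b p, vb_dom L a p -> vb_dom L b p -> ~ V p ->
       vb_trans L a b p = (f a p ^ k / f b p ^ k)%:M).

(* {(z, l) in D x P^(n-1) : z_i l_j = z_j l_i for all i, j}, a point of
   P^(n-1) being a line in C^n. *)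
Definition local_blowup (R : realType) (n : nat) (D : set 'rV[Cplx R]_n) :
    set ('rV[Cplx R]_n * {vspace 'rV[Cplx R]_n}) :=
  [set u | [/\ D u.1, \dim u.2 = 1%N
             & forall l : 'rV[Cplx R]_n, l \in u.2 -> forall i j,
                 u.1 ord0 i * l ord0 j = u.1 ord0 j * l ord0 i]].

(* Affine coordinates on the part l_k <> 0 of the local blow-up: w_k = z_k and
   w_j = l_j / l_k for j <> k; below, w is sent to the point (z, [l]) with
   l = (w_0, .., 1, .., w_(n-1)), 1 in position k, and z = w_k l. *)
Definition affine_direction (R : realType) (n : nat) (k : 'I_n)
    (w : 'rV[Cplx R]_n) : 'rV[Cplx R]_n :=
  \row_j (if j == k then 1 else w ord0 j).

Definition affine_blowup (R : realType) (n : nat) (k : 'I_n)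
    (w : 'rV[Cplx R]_n) : 'rV[Cplx R]_n * {vspace 'rV[Cplx R]_n} :=
  (w ord0 k *: affine_direction k w, <[affine_direction k w]>%VS).

(* pi : Mt -> M is obtained by gluing M \ {x} (embedded by iota) and the local
   blow-up (embedded by kappa) of a coordinate neighbourhood cdom c of x, with
   coordinates centered at x.  The last clause says that kappa is biholomorphic
   onto an open set: it carries the affine coordinates of the local blow-up to
   holomorphic coordinates of Mt. *)
Definition is_blowup (R : realType) (n : nat) (M Mt : complex_manifold R n)
    (x : M) (pi : holomorphic_map Mt M) : Prop :=
  (exists iota : M -> Mt,
     [/\ holomorphic_on (~` [set x]) iota,
         forall p, p <> x -> pi (iota p) = p
       & forall q, pi q <> x -> iota (pi q) = q]) /\
  (exists (c : chart R n M)
          (kappa : 'rV[Cplx R]_n * {vspace 'rV[Cplx R]_n} -> Mt),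
     [/\ holomorphic_chart c, cdom c x, cto c x = 0,
         set_bij (local_blowup (ccod c)) (pi @^-1` cdom c) kappa
       & (forall u, local_blowup (ccod c) u -> pi (kappa u) = cfrom c u.1) /\
         (forall k : 'I_n, exists e : chart R n Mt,
            [/\ holomorphic_chart e,
                ccod e = [set w | ccod c (affine_blowup k w).1]
              & forall w, ccod e w -> cfrom e w = kappa (affine_blowup k w)])]).

(* Main.v *)
Require Import Defs.
From mathcomp Require Import all_boot all_order all_algebra.
From mathcomp Require Import boolp classical_sets functions reals topology.
From mathcomp Require Import normedtype derive.

Local Open Scope classical_set_scope.
Local Open Scope ring_scope.

Set Implicit Arguments.
Unset Strict Implicit.
Unset Printing Implicit Defensive.

Import Order.TTheory GRing.Theory Num.Theory numFieldNormedType.Exports.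

(** Pulling back holomorphic n-forms by the blow-up map pi multiplies their
    coordinate by the Jacobian determinant det J(pi).  Away from the exceptional
    divisor E the map pi is biholomorphic and det J(pi) is a nonvanishing
    function.  In the affine coordinates w of the blow-up, where pi is
    w |-> w_k (w_0, .., 1, .., w_(n-1)), it equals w_k^(n-1)
    ([det_jacobian_affine_blowup]), while w_k = 0 is the equation of E
    ([exceptional_chart]).  So K_Mt and pi^* K_M differ by the divisor (n-1)E.

    In trivializations i of K_Mt, a of pi^* K_M and al of [(n-1)E], with f_al
    the chosen local equation of E, the isomorphism is multiplication by
    f_al^(n-1) / det J(pi).  The chain rule for Jacobians makes these functions
    compatible with the transition functions off E ([det_map_jacobian_change]).
    They extend to nonvanishing holomorphic functions across E: since f_al
    generates the ideal of E, w_k = h f_al with h holomorphic, and h cannot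
    vanish on E because dw_k does not ([coordinate_cofactor_neq0]); so
    f_al^(n-1) / det J(pi) is h^(1-n) times inverse Jacobian determinants of
    changes of coordinates.

    Finally, E has dense complement ([dense_off_exceptional]), so the local
    extensions agree on overlaps and remain compatible on E: this is
    [bundle_iso_extension]. *)

(** * Holomorphic functions on a manifold *)

Section HolomorphicFunctions.
Context {R : realType} {n : nat} {M : complex_manifold R n}.
Implicit Types (U W : set M) (f g : M -> Cplx R).

Lemma holomorphic_fun_sub U W f :
  W `<=` U -> holomorphic_fun U f -> holomorphic_fun W f.
Proof.
by move=> WU hf i k; apply: (cdiff_sub _ (hf i k)) => z [/= cz /WU].
Qed.

Lemma holomorphic_fun_ext W f g : open W -> (forall p, W p -> f p = g p) ->
  holomorphic_fun W f -> holomorphic_fun W g.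
Proof.
move=> oW fg hf i k; apply: (cdiff_ext (chart_open _ oW)) (hf i k).
by move=> z [/= _ /fg].
Qed.

Lemma holomorphic_fun_local U f :
  (forall p, U p -> exists2 W, W p & holomorphic_fun W f) ->
  holomorphic_fun U f.
Proof.
move=> loc i k; apply: cdiff_local => z [/= cz /loc[W Wz hf]].
exists (ccod (atlas M i) `&` cfrom (atlas M i) @^-1` W); first by split.
exact: hf.
Qed.

Lemma holomorphic_funM W f g : open W -> holomorphic_fun W f ->
  holomorphic_fun W g -> holomorphic_fun W (fun p => f p * g p).
Proof. by move=> oW hf hg i k; exact: cdiffM (chart_open _ oW) (hf i k) (hg i k). Qed.

Lemma holomorphic_funV W f : open W -> (forall p, W p -> f p != 0) ->
  holomorphic_fun W f -> holomorphic_fun W (fun p => (f p)^-1).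
Proof.
move=> oW f0 hf i k; apply: cdiffV (chart_open _ oW) _ (hf i k).
by move=> z [/= _ /f0].
Qed.

Lemma holomorphic_funX W f d : open W -> holomorphic_fun W f ->
  holomorphic_fun W (fun p => f p ^+ d).
Proof.
move=> oW hf; elim: d => [|d IH]; first by move=> i k; exact: cdiff_cst.
under eq_fun do rewrite exprS; exact: (holomorphic_funM oW hf IH).
Qed.

Lemma holomorphic_funXz W f (m : int) : open W -> (forall p, W p -> f p != 0) ->
  holomorphic_fun W f -> holomorphic_fun W (fun p => f p ^ m).
Proof.
move=> oW f0 hf; case: m => d; first exact: (holomorphic_funX d oW hf).
apply: (holomorphic_funV oW _ (holomorphic_funX d.+1 oW hf)) => p Wp.
by rewrite expf_neq0// f0.
Qed.

Lemma holomorphic_fun_scalar_mx W f : holomorphic_fun W f ->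
  forall s t : 'I_1, holomorphic_fun W (fun p => (f p)%:M s t).
Proof.
by move=> hf s t; rewrite !ord1; under eq_fun do rewrite !mxE eqxx mulr1n.
Qed.

Lemma holomorphic_fun_mulmx p q r W (F : M -> 'M[Cplx R]_(p, q))
    (G : M -> 'M[Cplx R]_(q, r)) : open W ->
  (forall s t, holomorphic_fun W (fun y => F y s t)) ->
  (forall s t, holomorphic_fun W (fun y => G y s t)) ->
  forall s t, holomorphic_fun W (fun y => (F y *m G y) s t).
Proof.
move=> oW hF hG s t i k.
apply: cdiff_mulmx (chart_open _ oW) _ _ _ _ => a b.
  exact: hF.
exact: hG.
Qed.

Lemma holomorphic_fun_det r W (F : M -> 'M[Cplx R]_r) : open W ->
  (forall s t, holomorphic_fun W (fun y => F y s t)) ->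
  holomorphic_fun W (fun y => \det (F y)).
Proof.
move=> oW hF i k; apply: cdiff_det (chart_open _ oW) _ => a b; exact: hF.
Qed.

(** Holomorphy is defined through the charts of the atlas only; composing with
    transition maps transfers it to every chart of the maximal atlas. *)
Lemma holomorphic_fun_chart (c : chart R n M) W f : open W ->
  holomorphic_chart c -> holomorphic_fun W f ->
  holomorphic (ccod c `&` cfrom c @^-1` W) (f \o cfrom c).
Proof.
move=> oW hc hf k; apply: cdiff_local => z [/= cz Wz].
have [i iz] := atlas_cover M (cfrom c z); set d := atlas M i.
pose B := ccod c `&` cfrom c @^-1` (W `&` cdom d).
have oB : open B by apply: chart_open; apply: openI => //; exact: cdom_open.
exists B => //.
have H : cdiff k B ((fun w => f (cfrom d w)) \o (fun w => cto d (cfrom c w))).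
  apply: (cdiff_comp oB) (hf i k).
  - by move=> w [/= cw [Ww dw]]; split; [exact: cto_cod|rewrite /= ctoK].
  - move=> s; apply: (cdiff_sub _ ((hc i).2 s k)).
    by move=> w [/= cw [Ww dw]].
by apply: (cdiff_ext oB) H => w [/= cw [Ww dw]]; rewrite ctoK.
Qed.

Lemma holomorphic_fun_continuous W f p : open W -> holomorphic_fun W f -> W p ->
  {for p, continuous f}.
Proof.
move=> oW hf Wp; have [i ip] := atlas_cover M p; set c := atlas M i.
have [df _] := hf i 1%N.
have cfc : {for cto c p, continuous (f \o cfrom c)}.
  apply: differentiable_continuous; apply: df; split => /=.
    exact: cto_cod.
  by rewrite ctoK.
have E : \forall q \near p, (f \o cfrom c \o cto c) q = f q.
  by apply: (near_open (cdom_open c) ip) => q cq /=; rewrite ctoK.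
have H := continuous_comp (cto_continuous c ip) cfc.
have fE : (f \o cfrom c \o cto c) p = f p by rewrite /= ctoK.
suff: f @ p --> f p by [].
by rewrite -[X in _ --> X]fE; apply: cvg_trans H; exact: near_eq_cvg.
Qed.

Lemma holomorphic_fun_neq0_open W f : open W -> holomorphic_fun W f ->
  open (W `&` [set p | f p != 0]).
Proof.
move=> oW hf; apply: (@open_preimage _ _ W [set y | y != 0] f) => //.
  by move=> p; exact: holomorphic_fun_continuous.
have -> : [set y : Cplx R | y != 0] = ~` [set 0].
  by apply/seteqP; split=> y /=; [move/eqP|move=> ?; apply/eqP].
apply: closed_openC; apply: accessible_closed_set1.
apply: hausdorff_accessible; exact: norm_hausdorff.
Qed.

(** Continuity is enough here: the open set where f - g is nonzero would meet
    the dense complement of V. *)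
Lemma holomorphic_fun_eq_dense (V W : set M) f g : dense (~` V) -> open W ->
  holomorphic_fun W f -> holomorphic_fun W g ->
  (forall q, W q -> ~ V q -> f q = g q) -> forall q, W q -> f q = g q.
Proof.
move=> dV oW hf hg fg q Wq; apply/eqP; rewrite -subr_eq0; apply/negPn/negP => ne.
have hfg : holomorphic_fun W (fun p => f p - g p).
  move=> i k; under eq_fun do rewrite -mulN1r.
  apply: cdiffD (chart_open _ oW) (hf i k) _.
  by apply: cdiffM (chart_open _ oW) (cdiff_cst _ _ _) (hg i k).
have [|p [[Wp /= fgp] Vp]] := dV _ _ (holomorphic_fun_neq0_open oW hfg).
  by exists q.
by move: fgp; rewrite fg// subrr eqxx.
Qed.

End HolomorphicFunctions.

(** * Jacobian matrices *)

Section Jacobian.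
Context {K : numFieldType}.

Definition row_differentiable m n (f : 'rV[K]_m -> 'rV[K]_n) z :=
  forall k, differentiable (fun w => f w ord0 k) z.

Lemma near_coord m n (f g : 'rV[K]_m -> 'rV[K]_n) (z : 'rV[K]_m) :
  (\forall w \near z, f w = g w) ->
  forall k, \forall w \near z, f w ord0 k = g w ord0 k.
Proof. by move=> fg k; apply: filterS fg => w ->. Qed.

Lemma row_differentiable_near m n (f g : 'rV[K]_m -> 'rV[K]_n) (z : 'rV[K]_m) :
  (\forall w \near z, f w = g w) ->
  row_differentiable f z -> row_differentiable g z.
Proof.
by move=> fg df k; apply: differentiable_near (near_coord fg k) (df k).
Qed.

Lemma jacobian_near m n (f g : 'rV[K]_m -> 'rV[K]_n) (z : 'rV[K]_m) :
  row_differentiable f z -> (\forall w \near z, f w = g w) -> 'J f z = 'J g z.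
Proof.
move=> df fg; have dg := row_differentiable_near fg df.
apply/matrixP => a b; apply: etrans (jacobian_entry a b df) _.
apply: etrans (esym (jacobian_entry a b dg)).
exact: derive_near (near_coord fg b).
Qed.

Lemma jacobian_comp l m n (f : 'rV[K]_l -> 'rV[K]_m) (g : 'rV[K]_m -> 'rV[K]_n) z :
  row_differentiable f z -> row_differentiable g (f z) ->
  row_differentiable (g \o f) z /\ 'J (g \o f) z = 'J f z *m 'J g (f z).
Proof.
move=> df dg; have dgf : row_differentiable (g \o f) z.
  move=> k; apply: (@differentiable_comp _ _ _ _ f (fun w => g w ord0 k)) (dg k).
  exact: differentiable_row.
split=> //; apply/matrixP => a b; apply: etrans (jacobian_entry a b dgf) _.
rewrite [RHS]mxE; apply: etrans (derive_comp_row _ df (dg b)) _.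
apply: eq_bigr => j _; congr (_ * _).
  exact: esym (jacobian_entry a j df).
exact: esym (jacobian_entry j b dg).
Qed.

End Jacobian.

(** * Jacobians of maps between manifolds *)

Section MapJacobian.
Context {R : realType}.

Definition map_jacobian m n (X Y : topologicalType) (c : chart R m X)
    (d : chart R n Y) (F : X -> Y) (p : X) : 'M[Cplx R]_(m, n) :=
  'J (cto d \o F \o cfrom c) (cto c p).

Definition chart_differentiable m n (X Y : topologicalType) (c : chart R m X)
    (d : chart R n Y) (F : X -> Y) (p : X) :=
  row_differentiable (cto d \o F \o cfrom c) (cto c p).

Lemma near_chart m (X : topologicalType) (c : chart R m X) p (P : X -> Prop) :
  cdom c p -> (\forall q \near p, P q) ->
  \forall w \near cto c p, P (cfrom c w).
Proof.
move=> cp np; have := cfrom_continuous c (cto_cod c cp).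
by rewrite /prop_for /continuous_at ctoK//; apply.
Qed.

Lemma chart_jacobianE n (X : topologicalType) (c d : chart R n X) p :
  chart_jacobian c d p = map_jacobian c d id p.
Proof. by []. Qed.

Lemma map_jacobian_near m n (X Y : topologicalType) (c : chart R m X)
    (d : chart R n Y) (F G : X -> Y) p :
  cdom c p -> chart_differentiable c d F p ->
  (\forall q \near p, F q = G q) ->
  map_jacobian c d F p = map_jacobian c d G p.
Proof.
move=> cp dF FG; apply: jacobian_near => //.
by apply: filterS (near_chart cp FG) => w /= ->.
Qed.

(** The one chain rule behind all changes of coordinates below: taking F or G to
    be the identity gives the change of the source or target chart. *)
Lemma map_jacobian_comp l m n (X Y Z : topologicalType) (c : chart R l X)
    (d : chart R m Y) (e : chart R n Z) (F : X -> Y) (G : Y -> Z) p :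
  {for p, continuous F} -> cdom c p -> cdom d (F p) ->
  chart_differentiable c d F p -> chart_differentiable d e G (F p) ->
  chart_differentiable c e (G \o F) p /\
  map_jacobian c e (G \o F) p = map_jacobian c d F p *m map_jacobian d e G (F p).
Proof.
move=> cF cp dFp dF dG.
have Ep : (cto d \o F \o cfrom c) (cto c p) = cto d (F p) by rewrite /= ctoK.
move: dG; rewrite /chart_differentiable /map_jacobian -Ep => dG.
have [dGF <-] := jacobian_comp dF dG.
have nE : \forall w \near cto c p,
    ((cto e \o G \o cfrom d) \o (cto d \o F \o cfrom c)) w
    = (cto e \o (G \o F) \o cfrom c) w.
  have : \forall q \near p, cdom d (F q).
    by apply: cF; apply: open_nbhs_nbhs; split=> //; exact: cdom_open.
  move=> /(near_chart cp); apply: filterS => w dw.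
  by rewrite /= ctoK.
split; first exact: row_differentiable_near nE dGF.
by rewrite (jacobian_near dGF nE).
Qed.

Lemma map_jacobian_holomorphic m n (M : complex_manifold R m)
    (Y : topologicalType) (c : chart R m M) (d : chart R n Y) (F : M -> Y)
    (W : set M) : open W -> W `<=` cdom c -> holomorphic_chart c ->
  (forall k, holomorphic (ccod c `&` cfrom c @^-1` W)
               (fun z => cto d (F (cfrom c z)) ord0 k)) ->
  forall a b, holomorphic_fun W (fun p => map_jacobian c d F p a b).
Proof.
move=> oW Wc hc hF a b l k; set A := (X in cdiff k X); set c' := atlas M l.
have oA : open A by exact: chart_open.
pose f := fun z => cto c (cfrom c' z).
have H : cdiff k A ((fun w => 'D_(delta_mx ord0 a)
    (fun w => (cto d \o F \o cfrom c) w ord0 b) w) \o f).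
  apply: (cdiff_comp (B := ccod c `&` cfrom c @^-1` W)) => //.
  - move=> z [/= cz Wz]; split; first by exact/cto_cod/Wc.
    by rewrite /f /= ctoK//; exact: Wc.
  - move=> s; have := (hc l).1 s; move/(_ k); apply: cdiff_sub.
    by move=> z [/= cz /Wc].
  - by have [_] := hF b k.+1; apply.
apply: (cdiff_ext oA) H => z [/= cz Wz].
have dF : row_differentiable (cto d \o F \o cfrom c) (cto c (cfrom c' z)).
  move=> j; have [+ _] := hF j 1%N; apply; split => /=; first by exact/cto_cod/Wc.
  by rewrite ctoK//; exact: Wc.
exact: esym (jacobian_entry a b dF).
Qed.

End MapJacobian.

Lemma derive_product_of_zeros (K : numFieldType) (V : normedModType K)
    (f g : V -> K) z v : differentiable f z -> differentiable g z ->
  f z = 0 -> g z = 0 -> 'D_v (f * g) z = 0.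
Proof.
move=> df dg fz gz; rewrite deriveM; [|exact: diff_derivable..].
by rewrite fz gz !scale0r addr0.
Qed.

Section Charts.
Context {R : realType} {n : nat} {M : complex_manifold R n}.

Lemma atlas_holomorphic_chart i : holomorphic_chart (atlas M i).
Proof. by move=> j; split; exact: atlas_transition. Qed.

Lemma chart_jacobian_unit i (c : chart R n M) p : holomorphic_chart c ->
  cdom (atlas M i) p -> cdom c p ->
  chart_jacobian (atlas M i) c p \in unitmx /\
  chart_jacobian c (atlas M i) p \in unitmx.
Proof.
move=> hc ip cp.
have [ic ci] := hc i.
have := chart_jacobian_comp ic ci (@atlas_transition _ _ _ i i) ip cp ip.
by rewrite (chart_jacobian_id ip) => /mulmx1_unit.
Qed.

Lemma canonical_transE i j p :
  vb_trans (canonical_bundle M) i j p =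
  ((\det (chart_jacobian (atlas M j) (atlas M i) p))^-1)%:M.
Proof. by rewrite /= trmxK det_inv. Qed.

Lemma det_chart_jacobian_holomorphic (c d : chart R n M) :
  holomorphic_chart c -> transition_holomorphic c d ->
  holomorphic_fun (cdom c `&` cdom d) (fun p => \det (chart_jacobian c d p)).
Proof.
move=> hc cd; have oW : open (cdom c `&` cdom d) by apply: openI; exact: cdom_open.
apply: holomorphic_fun_det => //.
apply: (@map_jacobian_holomorphic _ _ _ _ _ c d id) => // k l.
by apply: cdiff_sub (cd k l) => z [/= cz []].
Qed.

(** By the Leibniz rule a coordinate, having nonzero differential, is not the
    product of two functions that both vanish at p. *)
Lemma coordinate_cofactor_neq0 (e : chart R n M) k (W : set M)
    (f h : M -> Cplx R) p :
  holomorphic_chart e -> cdom e p -> open W -> W p ->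
  holomorphic_fun W f -> holomorphic_fun W h ->
  (forall q, W q -> cto e q ord0 k = h q * f q) -> f p = 0 -> h p != 0.
Proof.
move=> he ep oW Wp hf hh tE fp0; apply/eqP => hp0.
set w := cto e p; have ew : ccod e w by exact: cto_cod.
have df : differentiable (f \o cfrom e) w.
  have [+ _] := holomorphic_fun_chart oW he hf 1; apply.
  by split=> //=; rewrite ctoK.
have dh : differentiable (h \o cfrom e) w.
  have [+ _] := holomorphic_fun_chart oW he hh 1; apply.
  by split=> //=; rewrite ctoK.
have E : \forall y \near w,
    (fun y : 'rV[Cplx R]_n => y ord0 k) y = ((h \o cfrom e) * (f \o cfrom e)) y.
  apply: (near_open (chart_open e oW)); first by split=> //=; rewrite ctoK.
  by move=> y [/= ey Wy]; rewrite /= -[y in LHS](cfromK e ey) tE.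
have := derive_near (delta_mx ord0 k) E.
have fw : (f \o cfrom e) w = 0 by rewrite /= ctoK.
have hw : (h \o cfrom e) w = 0 by rewrite /= ctoK.
rewrite (derive_product_of_zeros _ dh df hw fw) derive_coord mxE !eqxx => /eqP.
by rewrite oner_eq0.
Qed.

End Charts.

Section HolomorphicMaps.
Context {R : realType} {n : nat} {M Mt : complex_manifold R n}
  (pi : holomorphic_map Mt M).

Lemma holomorphic_map_continuous p : {for p, continuous pi}.
Proof. by have [+ _] := map_holomorphic pi; apply. Qed.

Lemma open_preimage_map (B : set M) : open B -> open (pi @^-1` B).
Proof.
have /continuousP : continuous pi by move=> p; exact: holomorphic_map_continuous.
exact.
Qed.

Lemma atlas_chart_differentiable i a p : cdom (atlas Mt i) p ->
  cdom (atlas M a) (pi p) -> chart_differentiable (atlas Mt i) (atlas M a) pi p.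
Proof.
move=> ip ap k; have [_ /(_ i a k 1%N) [+ _]] := map_holomorphic pi; apply.
by split=> /=; [exact: cto_cod|rewrite ctoK].
Qed.

(** Both sides are the determinant of pi read from the chart i to the chart b,
    factored through j in the source or through a in the target. *)
Lemma det_map_jacobian_change i j a b p :
  cdom (atlas Mt i) p -> cdom (atlas Mt j) p ->
  cdom (atlas M a) (pi p) -> cdom (atlas M b) (pi p) ->
  \det (chart_jacobian (atlas Mt i) (atlas Mt j) p) *
    \det (map_jacobian (atlas Mt j) (atlas M b) pi p) =
  \det (map_jacobian (atlas Mt i) (atlas M a) pi p) *
    \det (chart_jacobian (atlas M a) (atlas M b) (pi p)).
Proof.
move=> ip jp ap bp.
have dij : chart_differentiable (atlas Mt i) (atlas Mt j) id p.
  exact: transition_differentiable (@atlas_transition _ _ _ i j) ip jp.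
have dab : chart_differentiable (atlas M a) (atlas M b) id (pi p).
  exact: transition_differentiable (@atlas_transition _ _ _ a b) ap bp.
have cid : {for p, continuous (@id Mt)} by exact: cvg_id.
have cpi := @holomorphic_map_continuous p.
have [_ E1] := map_jacobian_comp cid ip jp dij (atlas_chart_differentiable jp bp).
have [_ E2] := map_jacobian_comp cpi ip ap (atlas_chart_differentiable ip ap) dab.
have D1 := etrans (congr1 (fun A => \det A) E1) (det_mulmx _ _).
have D2 := etrans (congr1 (fun A => \det A) E2) (det_mulmx _ _).
exact: etrans (esym D1) D2.
Qed.

Lemma det_map_jacobian_holomorphic i a :
  holomorphic_fun (cdom (atlas Mt i) `&` pi @^-1` cdom (atlas M a))
    (fun p => \det (map_jacobian (atlas Mt i) (atlas M a) pi p)).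
Proof.
have oW : open (cdom (atlas Mt i) `&` pi @^-1` cdom (atlas M a)).
  by apply: openI; [|apply: open_preimage_map]; exact: cdom_open.
apply: holomorphic_fun_det => //.
apply: map_jacobian_holomorphic => //; first exact: atlas_holomorphic_chart.
move=> k l; have [_ /(_ i a k l)] := map_holomorphic pi; apply: cdiff_sub.
by move=> z [/= cz [_ az]].
Qed.

End HolomorphicMaps.

(** * Extending bundle isomorphisms *)

Section Extension.
Context {R : realType} {n : nat} {M : complex_manifold R n} {r : nat}.
Context (E F : vector_bundle M r) (V : set M)
  (h0 : vb_index E -> vb_index F -> M -> 'M[Cplx R]_r).

Let local_extension i a (W : set M) (H : M -> 'M[Cplx R]_r) :=
  [/\ open W, forall s t, holomorphic_fun W (fun q => H q s t),
      forall q, W q -> H q \in unitmx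
    & forall q, W q -> ~ V q -> H q = h0 i a q].

(** The value at a point is that of any local extension H; two extensions agree
    where both are defined by density of the complement of V, and the same
    density argument carries the cocycle relation across V. *)
Lemma bundle_iso_extension : dense (~` V) ->
  (forall i j a b p, vb_dom E i p -> vb_dom E j p -> vb_dom F a p ->
     vb_dom F b p -> ~ V p ->
     h0 j b p *m vb_trans E j i p = vb_trans F b a p *m h0 i a p) ->
  (forall i a p, vb_dom E i p -> vb_dom F a p ->
     exists (W : set M) (H : M -> 'M[Cplx R]_r),
     [/\ open W, W p, forall s t, holomorphic_fun W (fun q => H q s t),
         forall q, W q -> H q \in unitmx
       & forall q, W q -> ~ V q -> H q = h0 i a q]) ->
  bundle_iso E F.
Proof.
move=> dV cocycle ext.
pose h i a p : 'M[Cplx R]_r :=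
  xget 0 [set v | exists W H, [/\ local_extension i a W H, W p & H p = v]].
have hE i a W H q : local_extension i a W H -> W q -> h i a q = H q.
  move=> [oW hH uH HE] Wq; rewrite /h; case: xgetP => [v _|/(_ (H q)) []]; last first.
    by exists W, H.
  move=> [W' [H' [[oW' hH' _ HE'] W'q <-]]]; apply/matrixP => s t.
  pose U := W `&` W'; have oU : open U by exact: openI.
  apply: (holomorphic_fun_eq_dense (W := U) (f := fun y => H' y s t)
    (g := fun y => H y s t) dV oU _ _ _ (conj Wq W'q)).
  - by apply: holomorphic_fun_sub (hH' s t) => y [].
  - by apply: holomorphic_fun_sub (hH s t) => y [].
  - by move=> y [Wy W'y] nVy; rewrite HE'// HE.
have hext i a p : vb_dom E i p -> vb_dom F a p ->
    exists W H, local_extension i a W H /\ W p.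
  by move=> ip ap; have [W [H [? ? ? ? ?]]] := ext i a p ip ap; exists W, H.
have hol i a s t : holomorphic_fun (vb_dom E i `&` vb_dom F a) (fun p => h i a p s t).
  apply: holomorphic_fun_local => p [ip ap].
  have [W [H [WH Wp]]] := hext _ _ _ ip ap; exists W => //.
  have [oW hH _ _] := WH; apply: (holomorphic_fun_ext oW _ (hH s t)) => q Wq.
  by rewrite (hE _ _ _ _ _ WH).
exists h; split=> //.
  move=> i a p ip ap; have [W [H [WH Wp]]] := hext _ _ _ ip ap.
  by rewrite (hE _ _ _ _ _ WH)//; case: WH => _ _ + _; apply.
move=> i j a b p ip jp ap bp; apply/matrixP => s t.
pose U := (vb_dom E i `&` vb_dom E j) `&` (vb_dom F a `&` vb_dom F b).
have oU : open U by apply: openI; exact: vb_open2.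
have Up : U p by [].
apply: (holomorphic_fun_eq_dense (W := U)
  (f := fun y => (h j b y *m vb_trans E j i y) s t)
  (g := fun y => (vb_trans F b a y *m h i a y) s t) dV oU _ _ _ Up).
- apply: holomorphic_fun_mulmx => // s' t'.
    by apply: holomorphic_fun_sub (hol j b s' t') => y [[? ?] [? ?]].
  apply: holomorphic_fun_sub (vb_trans_holomorphic E j i s' t') => y.
  by move=> [[? ?] [? ?]].
- apply: holomorphic_fun_mulmx => // s' t'.
    apply: holomorphic_fun_sub (vb_trans_holomorphic F b a s' t') => y.
    by move=> [[? ?] [? ?]].
  by apply: holomorphic_fun_sub (hol i a s' t') => y [[? ?] [? ?]].
move=> q [[iq jq] [aq bq]] nVq.
have h0E i' a' : vb_dom E i' q -> vb_dom F a' q -> h i' a' q = h0 i' a' q.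
  move=> iq' aq'; have [W [H [WH Wq]]] := hext _ _ _ iq' aq'.
  by rewrite (hE _ _ _ _ _ WH)//; case: WH => _ _ _; apply.
by rewrite !h0E// (cocycle i j a b).
Qed.

End Extension.

(** * Affine charts of the blow-up of a point *)

(** The matrix is c times the identity with row k replaced by d.  Its column k is
    d_k times the k-th basis vector, and deleting row and column k leaves a
    scalar matrix. *)
Lemma det_row_replaced_scalar (K : comNzRingType) n (k : 'I_n) (d : 'rV[K]_n)
    (c : K) (A : 'M[K]_n) :
  (forall a b, A a b = (if a == k then d ord0 b else 0) +
                       (if (a == b) && (b != k) then c else 0)) ->
  \det A = d ord0 k * c ^+ n.-1.
Proof.
move=> AE; rewrite (expand_det_col A k) (bigD1 k)//= [X in _ + X]big1; last first.
  by move=> a ak; rewrite AE (negPf ak) eqxx andbF addr0 mul0r.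
rewrite AE !eqxx/= !addr0 /cofactor.
rewrite addnn -signr_odd odd_double expr0 mul1r -det_scalar.
congr (_ * \det _).
apply/matrixP => a b; rewrite !mxE AE.
rewrite !(eq_sym (lift k _) k) (negPf (neq_lift k a)) (inj_eq lift_inj).
by rewrite neq_lift andbT add0r; case: eqP.
Qed.

Section AffineBlowup.
Context {R : realType} {n : nat}.
Implicit Types (k : 'I_n) (w : 'rV[Cplx R]_n) (D : set 'rV[Cplx R]_n).

Lemma affine_direction_neq0 k w : affine_direction k w != 0.
Proof.
apply/eqP => /rowP /(_ k) /eqP; rewrite !mxE eqxx.
by rewrite oner_eq0.
Qed.

Lemma affine_blowup_local D k w :
  D (affine_blowup k w).1 -> local_blowup D (affine_blowup k w).
Proof.
move=> Dw; split=> //=; first by rewrite dim_vline affine_direction_neq0.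
move=> l /vlineP[a ->] i j; rewrite !mxE.
by rewrite mulrACA [RHS]mulrACA (mulrC (if i == k then _ else _)).
Qed.

(** Normalize a vector of the line so that a nonzero coordinate k becomes 1; the
    incidence equations then say that the base point is z_k times that vector. *)
Lemma local_blowup_affine D u :
  local_blowup D u -> exists k w, u = affine_blowup k w.
Proof.
case: u => z U [/= _ dU inc]; have vU := memv_pick U; set v := vpick U in vU.
have v0 : v != 0 by rewrite vpick0 -dimv_eq0 dU.
have [k vk] : exists k, v ord0 k != 0.
  apply/existsP; apply: contraNT v0; rewrite negb_exists => /forallP v0.
  by apply/eqP/rowP => j; rewrite mxE; apply/eqP/negPn.
pose w := \row_j (if j == k then z ord0 k else v ord0 j / v ord0 k).
exists k, w.
have dirE : affine_direction k w = (v ord0 k)^-1 *: v.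
  apply/rowP => j; rewrite !mxE; case: eqP => [->|_]; first by rewrite mulVf.
  by rewrite mulrC.
congr pair; last first.
  apply/esym/eqP; rewrite eqEdim dU dim_vline affine_direction_neq0 andbT.
  by rewrite -memvE dirE memvZ.
apply/rowP => j; rewrite dirE !mxE eqxx mulrCA mulrC.
by rewrite (inc v vU k j) mulfK.
Qed.

Lemma affine_blowup_eq0 k w : (affine_blowup k w).1 = 0 <-> w ord0 k = 0.
Proof.
split=> [/eqP|/= ->]; last by rewrite scale0r.
by rewrite scaler_eq0 (negPf (affine_direction_neq0 _ _)) orbF => /eqP.
Qed.

Let differentiable_entry k w j :
  differentiable (fun w => affine_direction k w ord0 j) w.
Proof.
rewrite (_ : (fun w => _) = (fun w => if j == k then 1 else w ord0 j)).
  by case: eqP => _; [exact: differentiable_cst|exact: differentiable_coord].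
by apply/funext => y; rewrite mxE.
Qed.

Let partialE (a j : 'I_n) w :
  'D_(delta_mx ord0 a) (fun w : 'rV[Cplx R]_n => w ord0 j) w = (a == j)%:R.
Proof. by rewrite derive_coord mxE eqxx eq_sym. Qed.

Let entryE k j : (fun w => (affine_blowup k w).1 ord0 j) =
  (fun w => w ord0 k * affine_direction k w ord0 j).
Proof. by apply/funext => y; rewrite mxE. Qed.

Lemma affine_blowup_differentiable k w :
  row_differentiable (fun w => (affine_blowup k w).1) w.
Proof.
move=> j; rewrite entryE; apply: differentiableM => //.
exact: differentiable_coord.
Qed.

Lemma jacobian_affine_blowup k w a b :
  'J (fun w => (affine_blowup k w).1) w a b =
  (if a == k then affine_direction k w ord0 b else 0) +
  (if (a == b) && (b != k) then w ord0 k else 0).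
Proof.
apply: etrans (jacobian_entry a b (affine_blowup_differentiable k w)) _.
rewrite entryE deriveM; [|apply: diff_derivable|apply: diff_derivable]; last 2 first.
- exact: differentiable_coord.
- exact: differentiable_entry.
rewrite partialE addrC; congr (_ + _).
  case: eqP => _; last by rewrite scaler0.
  exact: mulr1.
rewrite (_ : (fun w => _) = (fun w => if b == k then 1 else w ord0 b)); last first.
  by apply/funext => y; rewrite mxE.
case: eqP => _; first by rewrite derive_cst scaler0 andbF.
rewrite partialE andbT.
by case: eqP => _; [exact: mulr1|exact: mulr0].
Qed.

Lemma det_jacobian_affine_blowup k w :
  \det ('J (fun w => (affine_blowup k w).1) w) = w ord0 k ^+ n.-1.
Proof.
rewrite (det_row_replaced_scalar (jacobian_affine_blowup k w)) /=.
by rewrite mxE eqxx mul1r.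
Qed.

End AffineBlowup.

(** * The exceptional divisor *)

Lemma open_meets_line (K : numFieldType) (V : normedModType K) (A : set V) w v :
  open A -> A w -> exists2 s : K, s != 0 & A (w + s *: v).
Proof.
move=> oA Aw.
have line : continuous (fun s : K => w + s *: v).
  move=> s; apply: (@cvgD K V K (nbhs s) _ (fun=> w) (fun s => s *: v)).
    exact: cvg_cst.
  exact: scalel_continuous.
have : \forall s \near (0 : K)^', A (w + s *: v) /\ s != 0.
  near=> s; split; last by near: s; exact: nbhs_dnbhs_neq.
  near: s; apply: nbhs_dnbhs; apply: line.
  by apply: open_nbhs_nbhs; rewrite /= scale0r addr0.
by move=> /filter_ex [s [As s0]]; exists s.
Unshelve. all: by end_near. Qed.

Section ExceptionalDivisor.
Context {R : realType} {n : nat} {M Mt : complex_manifold R n} {x : M}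
  (pi : holomorphic_map Mt M) (pi_blowup : is_blowup x pi).

Lemma open_off_point : open (~` (pi @^-1` [set x])).
Proof.
rewrite preimage_setC; apply: open_preimage_map; apply: closed_openC.
apply: accessible_closed_set1; apply: hausdorff_accessible.
exact: space_hausdorff.
Qed.

(** The geometric content of the blow-up near its exceptional divisor, in the
    form used below: coordinates in which pi is the affine blow-up map and the
    k-th one is an equation of the divisor.  No such k exists when n = 0, and then
    the divisor is empty. *)
Lemma exceptional_chart p : pi p = x -> exists c e k,
  [/\ holomorphic_chart c, holomorphic_chart e, cdom e p,
      forall q, cdom e q ->
        cdom c (pi q) /\ cto c (pi q) = (affine_blowup k (cto e q)).1
    & forall q, cdom e q -> (pi q = x <-> cto e q ord0 k = 0)].
Proof.
move=> pip; case: pi_blowup => _ [c [kappa [hc cx cx0 bij [pik charts]]]].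
have [_ _ /(_ p)] := bij; rewrite /= pip => /(_ cx) [u uD up].
have [k [w uE]] := local_blowup_affine uD; move: uD up; rewrite uE => wD wp.
have [e [he ccodE cfromE]] := charts k; exists c, e, k.
have ew : ccod e w by rewrite ccodE; case: wD.
have Hpi q : cdom e q ->
    cdom c (pi q) /\ cto c (pi q) = (affine_blowup k (cto e q)).1.
  move=> eq; have := cto_cod e eq; set y := cto e q => ey.
  have Dy : ccod c (affine_blowup k y).1 by move: ey; rewrite ccodE.
  rewrite -(ctoK e eq) cfromE// pik; last exact: affine_blowup_local.
  by split; [exact: cfrom_dom|exact: cfromK].
split=> //; first by rewrite -wp -cfromE//; exact: cfrom_dom.
move=> q eq; have [cq E] := Hpi q eq; split=> [qx|t0].
  by apply/affine_blowup_eq0; rewrite -E qx cx0.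
by rewrite -(ctoK c cq) E (affine_blowup_eq0 _ _).2// -cx0 ctoK.
Qed.

Lemma dense_off_exceptional : dense (~` (pi @^-1` [set x])).
Proof.
move=> O [q Oq] oO; have [qx|qx] := pselect (pi q = x); last by exists q.
have [c [e [k [_ _ eq _ Ve]]]] := exceptional_chart qx.
set w := cto e q; pose A := ccod e `&` cfrom e @^-1` O.
have Aw : A w by split; [exact: cto_cod|rewrite /= ctoK].
pose v : 'rV[Cplx R]_n := delta_mx ord0 k.
(* Leave the divisor by moving the coordinate that cuts it out. *)
have [|s s0 [eA OA]] := open_meets_line v _ Aw; first exact: chart_open.
exists (cfrom e (w + s *: v)); split=> //.
rewrite /= Ve; last exact: cfrom_dom.
have /(Ve q eq) wk := qx.
rewrite cfromK// !mxE !eqxx mulr1 wk add0r.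
exact/eqP.
Qed.

(** Off the exceptional divisor pi has the holomorphic inverse iota, so its
    Jacobian matrix is invertible by the chain rule. *)
Lemma blowup_jacobian_unit i a p : cdom (atlas Mt i) p -> cdom (atlas M a) (pi p) ->
  pi p <> x -> map_jacobian (atlas Mt i) (atlas M a) pi p \in unitmx.
Proof.
move=> ip ap px; case: pi_blowup => [[iota [hiota piiota iotapi]] _].
have iE : \forall q \near p, (iota \o pi) q = q.
  by apply: (near_open open_off_point px) => q; exact: iotapi.
have ppi : cdom (atlas Mt i) (iota (pi p)) by rewrite iotapi.
have dpi := atlas_chart_differentiable ip ap.
have diota : chart_differentiable (atlas M a) (atlas Mt i) iota (pi p).
  move=> k; have [_ /(_ a i k 1%N) [+ _]] := hiota; apply.
  by split=> /=; [exact: cto_cod|rewrite ctoK].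
have [d E] := map_jacobian_comp (holomorphic_map_continuous (p := p)) ip ap dpi diota.
have J1 : map_jacobian (atlas Mt i) (atlas Mt i) (iota \o pi) p = 1%:M.
  apply: etrans (map_jacobian_near (G := id) ip d iE) _.
  by apply: etrans (esym (chart_jacobianE _ _ _)) (chart_jacobian_id ip).
exact: (mulmx1_unit (etrans (esym E) J1)).1.
Qed.

Lemma blowup_chart_jacobian (c : chart R n M) (e : chart R n Mt) k q :
  cdom e q ->
  (forall y, cdom e y ->
    cdom c (pi y) /\ cto c (pi y) = (affine_blowup k (cto e y)).1) ->
  chart_differentiable e c pi q /\
  \det (map_jacobian e c pi q) = cto e q ord0 k ^+ n.-1.
Proof.
move=> eq Hpi.
have E : \forall w \near cto e q,
    (affine_blowup k w).1 = (cto c \o pi \o cfrom e) w.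
  apply: (near_open (ccod_open e) (cto_cod e eq)) => w ew /=.
  by rewrite (Hpi _ (cfrom_dom e ew)).2 cfromK.
have dA := @affine_blowup_differentiable R n k (cto e q).
split; first exact: row_differentiable_near E dA.
apply: etrans (det_jacobian_affine_blowup k (cto e q)).
exact: esym (congr1 (fun A => \det A) (jacobian_near dA E)).
Qed.

(** Factor pi through the charts e and c, in which it is the affine blow-up map.
    The outer factors do not vanish, so det J(pi) vanishes to order n - 1. *)
Lemma det_map_jacobian_exceptional (c : chart R n M) (e : chart R n Mt) k i a q :
  holomorphic_chart c -> holomorphic_chart e ->
  (forall y, cdom e y ->
    cdom c (pi y) /\ cto c (pi y) = (affine_blowup k (cto e y)).1) ->
  cdom (atlas Mt i) q -> cdom e q -> cdom (atlas M a) (pi q) ->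
  \det (map_jacobian (atlas Mt i) (atlas M a) pi q) =
  \det (chart_jacobian (atlas Mt i) e q) * cto e q ord0 k ^+ n.-1 *
  \det (chart_jacobian c (atlas M a) (pi q)).
Proof.
move=> hc he Hpi iq eq aq; have [cq _] := Hpi q eq.
have [dec Dec] := blowup_chart_jacobian eq Hpi.
have die : chart_differentiable (atlas Mt i) e id q.
  exact: transition_differentiable (he i).1 iq eq.
have dca : chart_differentiable c (atlas M a) id (pi q).
  exact: transition_differentiable (hc a).2 cq aq.
have cid : {for q, continuous (@id Mt)} by exact: cvg_id.
have [dic Eic] := map_jacobian_comp cid iq eq die dec.
have cpi : {for q, continuous (pi \o id)} by exact: holomorphic_map_continuous.
have [_ Eia] := map_jacobian_comp cpi iq cq dic dca.
apply: etrans (congr1 (fun A => \det A) Eia) _.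
apply: etrans (det_mulmx _ _) _; congr (_ * _).
apply: etrans (congr1 (fun A => \det A) Eic) _.
apply: etrans (det_mulmx _ _) _; congr (_ * _).
exact: Dec.
Qed.

End ExceptionalDivisor.

(** * The canonical bundle of the blow-up *)

Lemma scalar_mx1_unit (K : fieldType) (c : K) : c != 0 -> (c%:M : 'M_1) \in unitmx.
Proof. by move=> c0; rewrite unitmxE det_scalar expr1 unitfE. Qed.

(** Compatibility of the quotients v / A and u / B, coordinates f^(n-1) / det J(pi)
    of the isomorphism, with the transition functions C^-1 of K_Mt, D^-1 of
    pi^* K_M and v / u of the divisor bundle. *)
Lemma frame_change_quotient (K : fieldType) (u v A B C D : K) :
  u != 0 -> C * A = B * D -> v / A / C = D^-1 * (v / u) * (u / B).
Proof.
move=> u0 E; rewrite -mulrA -invfM (mulrC A) E mulrA -(mulrA D^-1) divfK//.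
by rewrite invfM (mulrC D^-1) mulrA mulrAC.
Qed.

(** If the Jacobian determinant is A t^d B with t = h f, the powers of f cancel in
    f^d / det J(pi). *)
Lemma cancel_equation (K : fieldType) (f h A B : K) d : f != 0 ->
  (h ^+ d * A * B)^-1 = f ^+ d / (A * (h * f) ^+ d * B).
Proof.
move=> f0; have fd : f ^+ d != 0 by rewrite expf_neq0.
have -> : A * (h * f) ^+ d * B = f ^+ d * (h ^+ d * A * B).
  by rewrite exprMn [A * _]mulrC -!mulrA mulrCA.
by rewrite [in RHS]invfM [RHS]mulrA divff// mul1r.
Qed.

Theorem lemma6p1 (R : realType) (n : nat) (M Mt : complex_manifold R n) (x : M)
    (pi : holomorphic_map Mt M) (L : line_bundle Mt)
    (pi_blowup : is_blowup x pi)
    (L_divisor : divisor_line_bundle (n%:Z - 1) (pi @^-1` [set x]) L) :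
  bundle_iso (canonical_bundle Mt)
             (tensor_bundle (pullback_bundle pi (canonical_bundle M)) L).
Proof.
case: L_divisor => f [fdef Lf].
set m : int := n%:Z - 1; set V := pi @^-1` [set x].
have hf al : holomorphic_fun (vb_dom L al) (f al) by case: (fdef al).
have fV al p : vb_dom L al p -> (V p <-> f al p = 0) by case: (fdef al) => _ + _; apply.
pose h0 (i : vb_index (canonical_bundle Mt))
    (a : vb_index (tensor_bundle (pullback_bundle pi (canonical_bundle M)) L)) p
    : 'M[Cplx R]_1 :=
  (f a.2 p ^ m / \det (map_jacobian (atlas Mt i) (atlas M a.1) pi p))%:M.
apply: (bundle_iso_extension (V := V) (h0 := h0)).
- exact: dense_off_exceptional pi_blowup.
- move=> i j [a al] [b be] p ip jp [ap alp] [bp bep] nVp.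
  have fal : f al p ^ m != 0 by apply: expfz_neq0; apply/eqP => /(fV _ _ alp).
  have E := det_map_jacobian_change ip jp ap bp.
  have -> : vb_trans (tensor_bundle (pullback_bundle pi (canonical_bundle M)) L)
      (b, be) (a, al) p =
      vb_trans (canonical_bundle M) b a (pi p) *m vb_trans L be al p by [].
  rewrite (canonical_transE j i p) (canonical_transE b a (pi p)).
  rewrite (Lf be al p bep alp nVp) -!scalar_mxM; congr (_%:M).
  exact: frame_change_quotient fal E.
move=> i [a al] p /= ip [ap alp]; rewrite /h0 /=.
pose U := (cdom (atlas Mt i) `&` pi @^-1` cdom (atlas M a)) `&` vb_dom L al.
have oU : open U.
  apply: openI; last exact: vb_dom_open.
  by apply: openI; [|apply: open_preimage_map]; exact: cdom_open.
have [px|px] := pselect (pi p = x); last first.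
  pose W := U `&` ~` V; exists W, (h0 i (a, al)).
  have oW : open W by apply: openI => //; exact: open_off_point.
  have f0 q : W q -> f al q != 0.
    by move=> [[_ alq] nVq]; apply/eqP => /(fV _ _ alq).
  have J0 q : W q -> \det (map_jacobian (atlas Mt i) (atlas M a) pi q) != 0.
    move=> [[[iq aq] _] nVq].
    have := blowup_jacobian_unit pi_blowup iq aq nVq.
    by rewrite unitmxE unitfE.
  split=> // [s t|q Wq].
    apply: (holomorphic_fun_scalar_mx (W := W)
      (f := fun q => f al q ^ m / \det (map_jacobian (atlas Mt i) (atlas M a) pi q))).
    apply: holomorphic_funM => //.
      by apply: holomorphic_funXz => //; apply: holomorphic_fun_sub (hf al) => q [[]].
    apply: holomorphic_funV => //.
    by apply: holomorphic_fun_sub (det_map_jacobian_holomorphic pi i a) => q [[]].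
  apply: (@scalar_mx1_unit (Cplx R)); rewrite mulf_neq0 ?invr_eq0 ?J0//.
  by rewrite expfz_neq0 ?f0.
have [c [e [k [hc he ep Hpi Ve]]]] := exceptional_chart pi_blowup px.
(* The index k shows 0 < n, so the exponent n - 1 is a natural number here; off
   the divisor it may be -1. *)
have mE : m = n.-1%:Z.
  by rewrite /m -{1}(ltn_predK (ltn_ord k)) -addn1 PoszD addrK.
(* f al generates the ideal of the divisor, on which the k-th coordinate
   vanishes: the latter is h * f al near p. *)
have [_ _ /(_ p (cdom e) (fun q => cto e q ord0 k) alp)] := fdef al.
case=> [||||W0 [h [oW0 W0p W0sub hh tE]]].
- exact: cdom_open.
- exact: ep.
- by move=> j; exact: (he j).1.
- by move=> q eq Vq; exact: (Ve q eq).1.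
have W0e q : W0 q -> cdom e q by move=> /W0sub[].
have hp : h p != 0.
  apply: (coordinate_cofactor_neq0 he ep oW0 W0p _ hh tE).
    by apply: holomorphic_fun_sub (hf al) => q /W0sub[].
  exact: (fV al p alp).1.
pose W := U `&` (W0 `&` [set q | h q != 0]).
have oW : open W by apply: openI => //; exact: holomorphic_fun_neq0_open.
pose Jie q := \det (chart_jacobian (atlas Mt i) e q).
pose Jca q := \det (chart_jacobian c (atlas M a) (pi q)).
have Jie0 q : W q -> Jie q != 0.
  move=> [[[iq _] _] [W0q _]].
  by have [+ _] := chart_jacobian_unit he iq (W0e q W0q); rewrite unitmxE unitfE.
have Jca0 q : W q -> Jca q != 0.
  move=> [[[_ aq] _] [W0q _]].
  have [_ +] := chart_jacobian_unit hc aq (Hpi q (W0e q W0q)).1.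
  by rewrite unitmxE unitfE.
have h0W q : W q -> h q != 0 by move=> [_ [_]].
have H0 q : W q -> h q ^+ n.-1 * Jie q * Jca q != 0.
  move=> Wq; apply: mulf_neq0; last exact: Jca0.
  by apply: mulf_neq0; [apply: expf_neq0; exact: h0W|exact: Jie0].
have holJie : holomorphic_fun W Jie.
  apply: holomorphic_fun_sub
    (det_chart_jacobian_holomorphic (atlas_holomorphic_chart i) (he i).1).
  by move=> q [[[iq _] _] [/W0e]].
have holJca : holomorphic_fun W Jca.
  have oca : open (cdom c `&` cdom (atlas M a)) by apply: openI; exact: cdom_open.
  have hJ := det_chart_jacobian_holomorphic hc (hc a).2.
  apply: holomorphic_fun_sub (holomorphic_fun_comp pi oca hJ).
  by move=> q [[[_ aq] _] [/W0e eq _]]; split=> //=; exact: (Hpi q eq).1.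
exists W, (fun q => ((h q ^+ n.-1 * Jie q * Jca q)^-1)%:M); split=> //.
- apply: holomorphic_fun_scalar_mx; apply: holomorphic_funV => //.
  apply: holomorphic_funM => //; apply: holomorphic_funM => //.
  by apply: holomorphic_funX => //; apply: holomorphic_fun_sub hh => q [_ []].
- by move=> q Wq; apply: (@scalar_mx1_unit (Cplx R)); rewrite invr_eq0 H0.
move=> q [[[iq aq] alq] [W0q hq]] nVq.
apply: (congr1 (fun y : Cplx R => y%:M : 'M_1)).
have f0 : f al q != 0 by apply/eqP => /(fV _ _ alq).
rewrite mE (det_map_jacobian_exceptional hc he Hpi iq (W0e q W0q) aq) tE//.
exact: (@cancel_equation (Cplx R)).
Qed.
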